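(* Let $\mathcal{C}=\{c_{\bar n},\dots,c_{\bar1},c_0,c_1,\dots,c_n\}$. Let $S=R_{\Gamma\Gamma}(\cdot\,;z_i,z_j)$, $T=R_{\Delta\Gamma}(\cdot\,;z_i,z_j)$, $S'=R_{\Delta\Delta}(\cdot\,;z_j,z_i)$ and $T'=R_{\Delta\Gamma}(\cdot\,;z_j,z_i)$ be the colored stochastic R-vertex weights with the indicated types and (ordered) spectral parameters, and let $K$ be the cap weight that sends $+$ to $+$ and every other color to its opposite color. For $\epsilon_1,\epsilon_2,\epsilon_3,\epsilon_4\in\mathcal{C}$ put $$Z(I_5(\epsilon_1,\epsilon_2,\epsilon_3,\epsilon_4))=\sum_{s,\delta_1,\delta_2,\delta_3\in\mathcal{C}} S(\epsilon_2,\epsilon_1,\delta_1,s)\,T(\epsilon_3,s,\delta_2,\delta_3)\,K(\delta_1,\delta_2)\,K(\delta_3,\epsilon_4),$$ $$Z(I_6(\epsilon_1,\epsilon_2,\epsilon_3,\epsilon_4))=\sum_{s,\delta_2,\delta_3,\delta_4\in\mathcal{C}} S'(\epsilon_4,\epsilon_3,s,\delta_4)\,T'(s,\epsilon_2,\delta_2,\delta_3)\,K(\epsilon_1,\delta_2)\,K(\delta_3,\delta_4).$$ Then for all $\epsilon_1,\epsilon_2,\epsilon_3,\epsilon_4\in\mathcal{C}$, $$Z(I_5(\epsilon_1,\epsilon_2,\epsilon_3,\epsilon_4))=Z(I_6(\epsilon_1,\epsilon_2,\epsilon_3,\epsilon_4)).$$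
   Context: Parameters: $n\ge1$ is an integer; $q,z_i,z_j$ are indeterminates (equivalently, generic complex numbers for which every denominator is nonzero). For a spectral parameter $z$ write $z'=q+1-\frac1z$. The labels are ordered by $\bar n<\dots<\bar 1<0<1<\dots<n$, with $\overline{\bar\alpha}=\alpha$; $c_0$ is also written $+$; $c_\alpha$ and $c_{\bar\alpha}$ are opposite colors. R-vertices with ordered spectral parameters $(x,y)$: the weight $R_{XY}(\,\cdot\,;x,y)$ is a function of the colors (bottom-left, top-left, top-right, bottom-right). Configurations not listed have weight $0$. For every color $e$, $(e,e,e,e)\mapsto 1$, and for all labels $\alpha<\beta$: - $R_{\Gamma\Gamma}$, with $P=1-(q+1)y+qxy$: $(c_\alpha,c_\beta,c_\alpha,c_\beta)\mapsto\frac{x-y}{P}$, $(c_\beta,c_\alpha,c_\beta,c_\alpha)\mapsto\frac{q(x-y)}{P}$, $(c_\beta,c_\alpha,c_\alpha,c_\beta)\mapsto\frac{(1-qx)(1-y)}{P}$, $(c_\alpha,c_\beta,c_\beta,c_\alpha)\mapsto\frac{(1-x)(1-qy)}{P}$. - $R_{\Delta\Gamma}$: $(c_\alpha,c_\beta,c_\alpha,c_\beta)\mapsto\frac{x'+qy-(q+1)x'y}{1-x'y}$, $(c_\beta,c_\alpha,c_\beta,c_\alpha)\mapsto\frac{q^{-1}x'+y-(1+q^{-1})x'y}{1-x'y}$, $(c_\beta,c_\beta,c_\alpha,c_\alpha)\mapsto\frac{(1-x')(1-qy)}{1-x'y}$, $(c_\alpha,c_\alpha,c_\beta,c_\beta)\mapsto\frac{(1-q^{-1}x')(1-y)}{1-x'y}$.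 - $R_{\Delta\Delta}$, with $Q=q-(q+1)x'+x'y'$: $(c_\alpha,c_\beta,c_\alpha,c_\beta)\mapsto\frac{y'-x'}{Q}$, $(c_\beta,c_\alpha,c_\beta,c_\alpha)\mapsto\frac{q(y'-x')}{Q}$, $(c_\beta,c_\alpha,c_\alpha,c_\beta)\mapsto\frac{(1-x')(q-y')}{Q}$, $(c_\alpha,c_\beta,c_\beta,c_\alpha)\mapsto\frac{(1-y')(q-x')}{Q}$. Cap weights: $K(x,y)$, with $x$ the top color and $y$ the bottom color, is given by $K(+,+)=1$, $K(c_\alpha,c_{\bar\alpha})=K(c_{\bar\alpha},c_\alpha)=1$ for $1\le\alpha\le n$, and $K=0$ otherwise. *)

(* Defs.v *)
From mathcomp Require Import all_boot all_algebra.

Set Implicit Arguments.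
Unset Strict Implicit.
Unset Printing Implicit Defensive.

Import GRing.Theory.
Local Open Scope ring_scope.

(* The colors c_{bar n} < ... < c_{bar 1} < c_0 < c_1 < ... < c_n, listed in
   increasing order of label: the ordinal n + a is c_a and the ordinal n - a is
   c_{bar a}, for 0 <= a <= n.  The label order is the order of 'I_(2n+1). *)
Notation color n := 'I_(n.*2.+1).

Definition c_pos (n a : nat) : color n := inord (n + a).
Definition c_bar (n a : nat) : color n := inord (n - a).
Definition c_plus (n : nat) : color n := c_pos n 0.

Section Weights.

Variables (F : fieldType) (n : nat) (q : F).

(* The spectral parameter z' attached to z. *)
Definition dual_param (z : F) : F := q + 1 - z^-1.

(* The arguments of an R-weight are the colors at the bottom-left, top-left,
   top-right and bottom-right, in this order. *)

Definition R_GammaGamma (x y : F) (bl tl tr br : color n) : F :=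
  let P := 1 - (q + 1) * y + q * x * y in
  if [&& bl == tl, tl == tr & tr == br] then 1
  else if (bl == tr) && (tl == br) then
    if (bl < tl)%N then (x - y) / P else q * (x - y) / P
  else if (bl == br) && (tl == tr) then
    if (bl < tl)%N then (1 - x) * (1 - q * y) / P
    else (1 - q * x) * (1 - y) / P
  else 0.

Definition R_DeltaGamma (x y : F) (bl tl tr br : color n) : F :=
  let x' := dual_param x in
  let D := 1 - x' * y in
  if [&& bl == tl, tl == tr & tr == br] then 1
  else if (bl == tr) && (tl == br) then
    if (bl < tl)%N then (x' + q * y - (q + 1) * x' * y) / D
    else (q^-1 * x' + y - (1 + q^-1) * x' * y) / D
  else if (bl == tl) && (tr == br) then
    if (bl < tr)%N then (1 - q^-1 * x') * (1 - y) / D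
    else (1 - x') * (1 - q * y) / D
  else 0.

Definition R_DeltaDelta (x y : F) (bl tl tr br : color n) : F :=
  let x' := dual_param x in
  let y' := dual_param y in
  let Q := q - (q + 1) * x' + x' * y' in
  if [&& bl == tl, tl == tr & tr == br] then 1
  else if (bl == tr) && (tl == br) then
    if (bl < tl)%N then (y' - x') / Q else q * (y' - x') / Q
  else if (bl == br) && (tl == tr) then
    if (bl < tl)%N then (1 - y') * (q - x') / Q
    else (1 - x') * (q - y') / Q
  else 0.

(* The arguments are the top color and the bottom color. *)
Definition cap (x y : color n) : F :=
  if (x == c_plus n) && (y == c_plus n) then 1
  else if [exists a : 'I_n.+1, (0 < a)%N &&
             (((x == c_pos n a) && (y == c_bar n a)) ||
              ((x == c_bar n a) && (y == c_pos n a)))] then 1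
  else 0.

Definition Z_I5 (zi zj : F) (e1 e2 e3 e4 : color n) : F :=
  \sum_(s : color n) \sum_(d1 : color n) \sum_(d2 : color n) \sum_(d3 : color n)
    R_GammaGamma zi zj e2 e1 d1 s * R_DeltaGamma zi zj e3 s d2 d3 *
    cap d1 d2 * cap d3 e4.

Definition Z_I6 (zi zj : F) (e1 e2 e3 e4 : color n) : F :=
  \sum_(s : color n) \sum_(d2 : color n) \sum_(d3 : color n) \sum_(d4 : color n)
    R_DeltaDelta zj zi e4 e3 s d4 * R_DeltaGamma zj zi s e2 d2 d3 *
    cap e1 d2 * cap d3 d4.

End Weights.

(* Main.v *)
Require Import Defs.
From mathcomp Require Import all_boot all_algebra.
From mathcomp Require Import zify ring.

Set Implicit Arguments.
Unset Strict Implicit.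
Unset Printing Implicit Defensive.

Import GRing.Theory.
Local Open Scope ring_scope.

(* Each R-vertex weight is the sum of a term for paths that cross and a term
   for paths that turn, and the cap weight is the indicator of [rev_ord]; hence
   both partition functions are sums of four terms, indexed by the same four
   pairings of the boundary colors.  These terms agree one by one because the
   Delta-Gamma weight is symmetric in its spectral parameters and because the
   Delta-Delta weight with swapped parameters is the Gamma-Gamma weight rotated
   by a half turn. *)

(** The reversal k -> 2n - k of the ordinals exchanges n + a and n - a and fixes n, so it passes to
    the opposite color and fixes [c_plus]. *)
Lemma cap_rev_ord (F : fieldType) n (x y : color n) :
  cap F x y = (y == rev_ord x)%:R.
Proof.
rewrite /cap /c_plus /c_pos /c_bar.
have val_pos a : (a <= n)%N -> (inord (n + a) : color n) = (n + a)%N :> nat.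
  by move=> ?; rewrite inordK //; lia.
have val_bar a : (inord (n - a) : color n) = (n - a)%N :> nat.
  by rewrite inordK //; lia.
have ltx := ltn_ord x; have lty := ltn_ord y.
case: ifP => [/andP[/eqP-> /eqP->]|not_plus].
  by rewrite -val_eqE /= val_pos //; case: eqP => //; lia.
case: (altP (y =P rev_ord x)) => [y_rev|y_nrev]; last first.
  case: existsP => // -[a /andP[a_gt0 a_xy]]; case/eqP: y_nrev.
  have lta := ltn_ord a.
  by apply: val_inj; case/orP: a_xy => /andP[/eqP-> /eqP->] /=;
     rewrite val_pos ?val_bar //; lia.
case: existsP => // -[].
have yE : y = (n.*2 - x)%N :> nat by rewrite y_rev /=; lia.
have x_neq : x <> n :> nat.
  move=> xn; move/negP: not_plus; apply; rewrite -!val_eqE /= val_pos //.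
  by apply/andP; split; apply/eqP; lia.
(* With truncated subtraction one summand is 0, so the witness is the distance from x to the middle
   ordinal n; it is positive by [x_neq]. *)
have lta : ((x - n) + (n - x) < n.+1)%N by lia.
exists (Ordinal lta); rewrite -!val_eqE /= val_bar val_pos; lia.
Qed.

(** * Weights that depend only on the relative order of two colors *)

Section TrichotomyWeight.

Variables (F : fieldType) (n : nat).
Implicit Types a b c d : color n.

Definition tri (eq lt gt : F) a b : F :=
  if a == b then eq else if (a < b)%N then lt else gt.

Lemma tri_rev_ord eq lt gt a b :
  tri eq lt gt (rev_ord a) (rev_ord b) = tri eq lt gt b a.
Proof.
have ltn_rev : (rev_ord a < rev_ord b)%N = (b < a)%N.
  by rewrite /=; have := ltn_ord a; have := ltn_ord b; lia.
by rewrite /tri ltn_rev (inj_eq rev_ord_inj) eq_sym.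
Qed.

Lemma tri_rev_ordC eq lt gt a b :
  tri eq lt gt a (rev_ord b) = tri eq lt gt b (rev_ord a).
Proof. by rewrite -[in RHS]tri_rev_ord rev_ordK. Qed.

Lemma tri_swap eq lt gt a b : tri eq lt gt b a = tri eq gt lt a b.
Proof.
rewrite /tri eq_sym; case: eqP => // neq_ab.
have neq_val : a <> b :> nat by move/val_inj.
by do 2![case: ifP => // ?]; exfalso; lia.
Qed.

End TrichotomyWeight.

(** For a = b the two indicators coincide; the weight 1 is then assigned wholly to crossing and 0 to
    turning, so that it is counted once. *)
Lemma if_cross_turn (F : fieldType) (T : eqType) (a b c d : T) (lt : bool)
    (u1 u2 v1 v2 : F) :
  (if [&& a == b, b == c & c == d] then 1
   else if (a == c) && (b == d) then if lt then u1 else u2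
   else if (a == d) && (b == c) then if lt then v1 else v2 else 0) =
  (if a == b then 1 else if lt then u1 else u2) * ((c == a) && (d == b))%:R +
  (if a == b then 0 else if lt then v1 else v2) * ((c == b) && (d == a))%:R.
Proof.
rewrite [c == a]eq_sym [d == b]eq_sym [c == b]eq_sym [d == a]eq_sym.
move: c d; have [<-|neq_ab] := eqVneq a b => c d /=.
  have [<-|_] := eqVneq a c => /=; last by case: (a == d) => /=; ring.
  by case: eqP => _ /=; ring.
have [<-|_] := eqVneq a c => /=; last first.
  by rewrite [(b == c) && _]andbC; case: ifP => _ /=; ring.
rewrite [b == a]eq_sym (negbTE neq_ab) /=.
by case: ifP => _; rewrite ?andbF /=; ring.
Qed.

(** * Crossing and turning parts of the R-vertices, and their symmetries *)

Section Weights.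

Variables (F : fieldType) (n : nat) (q : F).
Implicit Types (x y : F) (a b c d : color n).

Definition GG_den x y : F := 1 - (q + 1) * y + q * x * y.
Definition GG_cross x y : color n -> color n -> F :=
  tri 1 ((x - y) / GG_den x y) (q * (x - y) / GG_den x y).
Definition GG_turn x y : color n -> color n -> F :=
  tri 0 ((1 - x) * (1 - q * y) / GG_den x y) ((1 - q * x) * (1 - y) / GG_den x y).

Definition DG_den x y : F := 1 - dual_param q x * y.
Definition DG_cross x y : color n -> color n -> F :=
  let x' := dual_param q x in
  tri 1 ((x' + q * y - (q + 1) * x' * y) / DG_den x y)
        ((q^-1 * x' + y - (1 + q^-1) * x' * y) / DG_den x y).
Definition DG_turn x y : color n -> color n -> F :=
  let x' := dual_param q x in
  tri 0 ((1 - q^-1 * x') * (1 - y) / DG_den x y)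
        ((1 - x') * (1 - q * y) / DG_den x y).

Lemma R_GammaGammaE x y a b c d :
  R_GammaGamma q x y a b c d =
    GG_cross x y a b * ((c == a) && (d == b))%:R +
    GG_turn x y a b * ((c == b) && (d == a))%:R.
Proof. exact: if_cross_turn. Qed.

Lemma R_DeltaGammaE x y a b c d :
  R_DeltaGamma q x y a b c d =
    DG_cross x y a b * ((c == a) && (d == b))%:R +
    DG_turn x y a c * ((b == a) && (d == c))%:R.
Proof.
rewrite /R_DeltaGamma /DG_cross /DG_turn /tri -/(DG_den x y).
rewrite [c == a]eq_sym [d == b]eq_sym [b == a]eq_sym [d == c]eq_sym.
have [<-|_] := eqVneq a b => /=; last by case: ifP => _ /=; ring.
have [<-|_] := eqVneq a c => /=; first by case: (a == d) => /=; ring.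
by case: ifP => _ /=; ring.
Qed.

Lemma R_DeltaDeltaE x y a b c d : x != 0 -> y != 0 -> GG_den x y != 0 ->
  R_DeltaDelta q y x a b c d =
    GG_cross x y a b * ((c == a) && (d == b))%:R +
    GG_turn x y b a * ((c == b) && (d == a))%:R.
Proof.
move=> x0 y0 D0; rewrite [LHS]if_cross_turn /GG_turn tri_swap.
(* The numerators carry the same factor 1 / (x * y): for instance 1 - x' = (1 - q * x) / x and q -
   y' = (1 - y) / y. It cancels in each quotient. *)
have -> : q - (q + 1) * dual_param q y + dual_param q y * dual_param q x =
          GG_den x y / (x * y).
  by rewrite /GG_den /dual_param; field; rewrite x0 y0.
rewrite /GG_cross /tri /dual_param.
by congr (_ * _ + _ * _); case: ifP => // _; case: ifP => _; field; rewrite x0 y0 D0.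
Qed.

(** The expression is x + y - (q + 1) * x * y, symmetric in x and y: it is both x * [DG_den x y]
    and, for y nonzero, y * [DG_den y x]. So one hypothesis serves both orders of the parameters. *)
Lemma DG_den_symm_neq0 x y : x != 0 -> DG_den x y != 0 ->
  y - ((q + 1) * y - 1) * x != 0.
Proof.
move=> x0 D0; have -> : y - ((q + 1) * y - 1) * x = x * DG_den x y.
  by rewrite /DG_den /dual_param; field.
by rewrite mulf_neq0.
Qed.

Lemma DG_crossC x y a b : x != 0 -> y != 0 -> q != 0 -> DG_den x y != 0 ->
  DG_cross x y a b = DG_cross y x a b.
Proof.
move=> x0 y0 q0 /(DG_den_symm_neq0 x0) D0.
rewrite /DG_cross /DG_den /dual_param.
by congr tri; field; rewrite y0 D0 ?q0 x0.
Qed.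

(** Multiplied by x, the numerators become (1 - x) * (1 - y) / q and (1 - q * x) * (1 - q * y), and
    the denominator becomes symmetric too. *)
Lemma DG_turnC x y a b : x != 0 -> y != 0 -> q != 0 -> DG_den x y != 0 ->
  DG_turn x y a b = DG_turn y x a b.
Proof.
move=> x0 y0 q0 /(DG_den_symm_neq0 x0) D0.
rewrite /DG_turn /DG_den /dual_param.
by congr tri; field; rewrite y0 D0 ?q0 x0.
Qed.

End Weights.

Lemma eq_mul_indicator (F : fieldType) (b1 b2 : bool) (x y : F) :
  b1 = b2 -> (b1 -> x = y) -> x * b1%:R = y * b2%:R.
Proof. by move=> <-; case: b1 => [->|_]; rewrite ?mulr0. Qed.

(** * Elimination of the inner colors *)

Section Sums.

Variables (F : fieldType) (n : nat).

Lemma sum_mul_indicator (T : finType) (a : T) (G : T -> F) :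
  \sum_d G d * (d == a)%:R = G a.
Proof.
by rewrite (bigD1 a) //= eqxx mulr1 big1 ?addr0 // => d /negbTE->; rewrite mulr0.
Qed.

Lemma sum2_mul_indicator (T : finType) (a b : T) (G : T -> T -> F) :
  \sum_c \sum_d G c d * ((c == a) && (d == b))%:R = G a b.
Proof.
under eq_bigr => c _.
  under eq_bigr => d _ do rewrite andbC -mulnb natrM mulrA.
  rewrite -mulr_suml sum_mul_indicator; over.
by rewrite sum_mul_indicator.
Qed.

Lemma sum2_mul_cross_turn (T : finType) (a b : T) (u v : F) (G : T -> T -> F) :
  \sum_c \sum_d (u * ((c == a) && (d == b))%:R + v * ((c == b) && (d == a))%:R) *
    G c d = u * G a b + v * G b a.
Proof.
rewrite -(sum2_mul_indicator a b) -(sum2_mul_indicator b a) !mulr_sumr.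
rewrite -big_split; apply: eq_bigr => c _.
rewrite !mulr_sumr -big_split; apply: eq_bigr => d _ /=; ring.
Qed.

Lemma cap_rev_ordl (x y : color n) : cap F x y = (x == rev_ord y)%:R.
Proof. by rewrite cap_rev_ord eq_sym (can2_eq rev_ordK rev_ordK). Qed.

Lemma Z_I5E (q x y : F) (e1 e2 e3 e4 : color n) :
  Z_I5 q x y e1 e2 e3 e4 =
    GG_cross q x y e2 e1 * R_DeltaGamma q x y e3 e1 (rev_ord e2) (rev_ord e4) +
    GG_turn q x y e2 e1 * R_DeltaGamma q x y e3 e2 (rev_ord e1) (rev_ord e4).
Proof.
(* The right side is re-expanded into a sum over the two right-hand colors of the Gamma-Gamma
   vertex; it then remains to let the caps fix [d2] and [d3]. *)
rewrite /Z_I5 exchange_big -[RHS](sum2_mul_cross_turn _ _ _ _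
  (fun c s => R_DeltaGamma q x y e3 s (rev_ord c) (rev_ord e4))).
apply: eq_bigr => c _; apply: eq_bigr => s _.
under eq_bigr => d2 _.
  under eq_bigr => d3 _ do rewrite (cap_rev_ordl d3).
  rewrite sum_mul_indicator cap_rev_ord; over.
by rewrite sum_mul_indicator R_GammaGammaE.
Qed.

Lemma Z_I6E (q x y : F) (e1 e2 e3 e4 : color n) :
  x != 0 -> y != 0 -> GG_den q x y != 0 ->
  Z_I6 q x y e1 e2 e3 e4 =
    GG_cross q x y e4 e3 * R_DeltaGamma q y x e4 e2 (rev_ord e1) (rev_ord e3) +
    GG_turn q x y e3 e4 * R_DeltaGamma q y x e3 e2 (rev_ord e1) (rev_ord e4).
Proof.
move=> x0 y0 D0; rewrite /Z_I6 -[RHS](sum2_mul_cross_turn _ _ _ _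
  (fun s d => R_DeltaGamma q y x s e2 (rev_ord e1) (rev_ord d))).
apply: eq_bigr => s _.
under eq_bigr => d2 _.
  rewrite exchange_big /=.
  under eq_bigr => d4 _.
    under eq_bigr => d3 _ do rewrite (cap_rev_ordl d3).
    rewrite sum_mul_indicator cap_rev_ord; over.
  over.
rewrite exchange_big; apply: eq_bigr => d _.
by rewrite sum_mul_indicator R_DeltaDeltaE.
Qed.

End Sums.

Theorem theorem3p3 (F : fieldType) (n : nat) (q zi zj : F)
  (hn : (1 <= n)%N)
  (hq : q != 0) (hzi : zi != 0) (hzj : zj != 0)
  (hGG : 1 - (q + 1) * zj + q * zi * zj != 0)
  (hDGij : 1 - dual_param q zi * zj != 0)
  (hDGji : 1 - dual_param q zj * zi != 0)
  (hDD : q - (q + 1) * dual_param q zj + dual_param q zj * dual_param q zi != 0)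
  (e1 e2 e3 e4 : color n) :
  Z_I5 q zi zj e1 e2 e3 e4 = Z_I6 q zi zj e1 e2 e3 e4.
Proof.
rewrite Z_I5E Z_I6E // !R_DeltaGammaE !mulrDr !mulrA.
rewrite -![DG_cross q zj zi _ _]DG_crossC // -![DG_turn q zj zi _ _]DG_turnC //.
have rev_eqC (a b : color n) : (rev_ord a == b) = (rev_ord b == a).
  by rewrite (can2_eq rev_ordK rev_ordK) eq_sym.
(* The indicators say, in order: e1, e4 opposite and e2, e3 opposite; e1 = e3 and e2 = e4; e1, e3
   opposite and e2, e4 opposite; e1 = e4 and e2 = e3. In the last two cases they agree literally on
   both sides. *)
congr ((_ + _) + (_ + _)); apply: eq_mul_indicator => //.
- by rewrite andbC rev_eqC [rev_ord e2 == _]rev_eqC.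
- move=> /andP[/eqP<- /eqP<-].
  by rewrite /GG_cross /DG_cross tri_rev_ord [in LHS]tri_rev_ordC.
- by rewrite andbC !(inj_eq rev_ord_inj) eq_sym [e1 == _]eq_sym.
- move=> /andP[/eqP<- /eqP/rev_ord_inj->].
  by rewrite /DG_turn [in LHS]tri_rev_ordC.
(* The crossing factors already agree; reversing both colors matches the turning factors. *)
- move=> /andP[/eqP<- /eqP<-].
  by congr (_ * _); rewrite /GG_turn -[LHS]tri_rev_ord rev_ordK.
- by move=> /andP[/eqP<- /eqP/rev_ord_inj->].
Qed.
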